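(* For a self-map $f:A\to A$ let $S_f:=\{f^m: m\geq 0\}$. For a finite sequence $(p_0,\ldots,p_n)$ of integers the following statements are equivalent: 1. there exist a finite discrete space $K$ and a map $f:K\to K$ such that $(p_0,\ldots,p_n)$ is the indicator sequence of $(K,S_f)$; 2. there exist a Fort space $X$ and a continuous map $f:X\to X$ such that $(p_0,\ldots,p_n)$ is the indicator sequence of $(X,S_f)$; 3. $p_0=0$ and for all $i\in\{1,\ldots,n\}$ we have $0\leq p_i-p_{i-1}\leq 1$. Moreover, (for given $n$) the collection of all sequences $(p_0,\ldots,p_n)$ of integers such that $p_0=0$ and $0\leq p_i-p_{i-1}\leq 1$ for all $i\in\{1,\ldots,n\}$ has $2^n$ elements.
   Context: A transformation semigroup $(Y,S)$ consists of a (nonempty) compact Hausdorff space $Y$, a discrete semigroup $S$ with identity $e$, and a continuous map $Y\times S\to Y$, $(x,s)\mapsto xs$, with $xe=x$ and $x(st)=(xs)t$ for all $x\in Y$, $s,t\in S$. Write $xS=\{xs:s\in S\}$. A nonempty subset $Z\subseteq Y$ is invariant if $zs\in Z$ for all $z\in Z$, $s\in S$. For a nonempty closed invariant $W\subseteq Y$, the height $h(W)\in\{0,1,2,\ldots\}\cup\{\infty\}$ is the supremum of all $n\ge 0$ for which there are distinct nonempty closed invariant subsets $Z_0\subset\cdots\subset Z_n=W$ of $(Y,S)$; $h(Y)$ is also written $h(Y,S)$. For finite $p\geq 0$, $h(Y,S)=p$ if and only if $\{\overline{yS}:y\in Y\}$ has exactly $p+1$ elements. If $h(Y,S)=p<\infty$,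 choose $y_0,\ldots,y_p\in Y$ with $\{\overline{yS}:y\in Y\}=\{\overline{y_0S},\ldots,\overline{y_pS}\}$ and $h(\overline{y_0S})\le\cdots\le h(\overline{y_pS})$; the indicator sequence of $(Y,S)$ is $(h(\overline{y_0S}),\ldots,h(\overline{y_pS}))$. It is defined only for finite height. For a continuous self-map $f:Y\to Y$ of a compact Hausdorff space, $S_f=\{f^m:m\ge 0\}$ (with $f^0=\mathrm{id}$) is a semigroup under composition, taken with the discrete topology and acting on $Y$ by $x\cdot f^m=f^m(x)$; this gives the transformation semigroup $(Y,S_f)$. A Fort space with particular point $b\in X$ is a set $X$ with the topology $\{U\subseteq X: b\notin U\text{ or }X\setminus U\text{ is finite}\}$ ($X$ may be finite or infinite). *)

(* Defs.v *)
From HB Require Import structures.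
From mathcomp Require Import all_boot all_order all_algebra.
From mathcomp Require Import all_classical.
From mathcomp Require Import constructive_ereal topology.

Set Implicit Arguments.
Unset Strict Implicit.
Unset Printing Implicit Defensive.

Import Order.TTheory GRing.Theory Num.Theory.

Local Open Scope classical_set_scope.
Local Open Scope ring_scope.

(* Giving [acting] the discrete topology makes [act_continuous] joint
   continuity on the product space. *)
Record transformation_semigroup := TransformationSemigroup {
  phase :> topologicalType;
  acting : monoidType;
  act : phase -> acting -> phase;
  phase_nonempty : [set: phase] !=set0;
  phase_compact : compact [set: phase];
  phase_hausdorff : hausdorff_space phase;
  act_continuous :
    continuous (fun z : phase * discrete_topology acting => act z.1 z.2);
  act1 : forall x, act x 1%g = x;
  actM : forall x s t, act x (s * t)%g = act (act x s) t
}.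

Section Height.
Variable T : transformation_semigroup.
Implicit Types (Z W : set T) (x : T).

Definition ts_orbit x : set T := range (act x).

Definition orbit_closure x : set T := closure (ts_orbit x).

Definition ts_invariant Z : Prop :=
  Z !=set0 /\ forall z (s : acting T), Z z -> Z (act z s).

Definition invariant_chain W (n : nat) : Prop :=
  exists Z : 'I_n.+1 -> set T,
    [/\ forall i, closed (Z i) /\ ts_invariant (Z i),
        forall i j : 'I_n.+1, (i < j)%N -> Z i `<` Z j
      & Z ord_max = W].

(* Every nonempty closed invariant W has a chain of length 0, so that the
   supremum below lies in {0, 1, 2, ...} U {+oo}; -oo is the supremum of the
   empty set and is only taken by other sets W. *)
Definition height W : \bar int :=
  supremum -oo%E [set n%:Z%:E | n in invariant_chain W].

Definition indicator_sequence (n : nat) (p : n.+1.-tuple int) : Prop :=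
  height [set: T] = n%:Z%:E /\
  exists y : 'I_n.+1 -> T,
    [/\ range orbit_closure = range (orbit_closure \o y),
        forall i j : 'I_n.+1, (i <= j)%N ->
          (height (orbit_closure (y i)) <= height (orbit_closure (y j)))%E
      & forall i, height (orbit_closure (y i)) = (tnth p i)%:E].

End Height.

Definition iterates (Y : Type) (f : Y -> Y) : set (Y -> Y) :=
  range (fun m => iter m f).

Definition iterates_type (Y : choiceType) (f : Y -> Y) : Type :=
  set_type (iterates f).

Section IteratesMonoid.
Variables (Y : choiceType) (f : Y -> Y).

HB.instance Definition _ := Choice.on (iterates_type f).

Lemma iteratesP (g : iterates_type f) : exists m, val g = iter m f.
Proof. by have /set_mem[m _ <-] := valP g; exists m. Qed.

Lemma iterates_comp (g h : iterates_type f) : val g \o val h \in iterates f.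
Proof.
have [[m gE] [k hE]] := (iteratesP g, iteratesP h); rewrite gE hE.
apply/mem_set; exists (m + k)%N => //.
by apply/funext => x /=; rewrite iterD.
Qed.

Lemma iterates_id : idfun \in iterates f.
Proof. by apply/mem_set; exists 0%N. Qed.

Definition iterates_mul (g h : iterates_type f) : iterates_type f :=
  SigSub (iterates_comp g h).

Definition iterates_one : iterates_type f := SigSub iterates_id.

Lemma iterates_mulA : associative iterates_mul.
Proof. by move=> g h k; apply: val_inj. Qed.

Lemma iterates_1mul : left_id iterates_one iterates_mul.
Proof. by move=> g; apply: val_inj. Qed.

Lemma iterates_mul1 : right_id iterates_one iterates_mul.
Proof. by move=> g; apply: val_inj. Qed.

HB.instance Definition _ := isMonoid.Build (iterates_type f)
  iterates_mulA iterates_1mul iterates_mul1.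

End IteratesMonoid.

Section IteratesAction.
Variables (Y : topologicalType) (f : Y -> Y).
Hypotheses (Y0 : [set: Y] !=set0) (Yc : compact [set: Y]).
Hypotheses (YH : hausdorff_space Y) (fc : continuous f).

Definition iterates_act (x : Y) (g : iterates_type f) : Y := val g x.

Lemma iterates_continuous (g : iterates_type f) : continuous (val g).
Proof.
have [m ->] := iteratesP g; elim: m => [|m IH] x /=; first exact: cvg_id.
by apply: (@continuous_comp _ _ _ (iter m f) f); [exact: IH|exact: fc].
Qed.

Lemma iterates_act_continuous :
  continuous (fun z : Y * discrete_topology (iterates_type f) =>
                iterates_act z.1 z.2).
Proof.
move=> [x g] A /(@iterates_continuous g x) gA.
exists ((val g) @^-1` A, [set g]); last by case=> y h [/= Ay ->].
by split => //; exact: (@discrete_set1 (discrete_topology (iterates_type f))).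
Qed.

Lemma iterates_act1 x : iterates_act x 1%g = x.
Proof. by []. Qed.

(* A right action of maps under composition: this uses that iterates of f
   commute. *)
Lemma iterates_actM x (g h : iterates_type f) :
  iterates_act x (g * h)%g = iterates_act (iterates_act x g) h.
Proof.
rewrite /iterates_act /=.
have [[m ->] [k ->]] := (iteratesP g, iteratesP h).
by rewrite -!iterD addnC.
Qed.

Definition iterates_ts : transformation_semigroup :=
  TransformationSemigroup Y0 Yc YH iterates_act_continuous
    iterates_act1 iterates_actM.

End IteratesAction.

Section FiniteDiscrete.
Variable K : discreteTopologicalType.

Lemma discrete_continuous (f : K -> K) : continuous f.
Proof.
move=> x; apply/discrete_cvg.
by apply: filterS (discrete_set1 x) => _ ->.
Qed.

Definition finite_discrete_ts (K0 : [set: K] !=set0)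
    (Kfin : finite_set [set: K]) (f : K -> K) : transformation_semigroup :=
  iterates_ts K0 (finite_compact Kfin) discrete_hausdorff
    (@discrete_continuous f).

End FiniteDiscrete.

Section Fort.
Variables (X : topologicalType) (b : X).

Definition fort_space : Prop :=
  forall U : set X, open U <-> (~ U b \/ finite_set (~` U)).

Lemma fort_nonempty : [set: X] !=set0.
Proof. by exists b. Qed.

Lemma fort_hausdorff : fort_space -> hausdorff_space X.
Proof.
move=> fort; rewrite open_hausdorff => x y xy.
have sep (u : X) : u <> b -> open [set u] /\ open (~` [set u]).
  move=> ub; split; apply/fort; first by left => /= bu; exact: ub.
  by right; rewrite setCK; exact: finite_set1.
have [xb|xb] := eqVneq x b.
  have yb : y <> b by move=> yb; move: xy; rewrite xb yb eqxx.
  have [oy oyC] := sep y yb.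
  exists (~` [set y], [set y]) => /=; last by rewrite setICl.
  by rewrite !inE; split => //; exact/eqP.
have [ox oxC] := sep x (elimN eqP xb).
exists ([set x], ~` [set x]) => /=; last by rewrite setICr.
by rewrite !inE; split => // /esym; exact/eqP.
Qed.

Lemma fort_compact : fort_space -> compact [set: X].
Proof.
rewrite compact_ultra => fort F UF FT.
have [Fb|] := pselect (F --> b); first by exists b.
move=> /existsNP[A /not_implyP[/= bA FA]].
have {}bA : finite_set (~` A).
  move: bA; rewrite nbhsE => -[U [/fort Uop Ub] UA].
  have {Uop} Ufin : finite_set (~` U) by case: Uop.
  by apply: sub_finite_set Ufin; exact: subsetC.
have [//|FAC] := in_ultra_setVsetC A UF.
have := finite_compact bA; rewrite compact_ultra => /(_ F UF FAC)[x [_ Fx]].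
by exists x.
Qed.

Definition fort_ts (Xfort : fort_space) (f : X -> X) (fc : continuous f) :
    transformation_semigroup :=
  iterates_ts fort_nonempty (fort_compact Xfort) (fort_hausdorff Xfort) fc.

End Fort.

Definition unit_step_sequence (n : nat) (p : n.+1.-tuple int) : Prop :=
  p`_0 = 0 /\ forall i, (1 <= i <= n)%N -> 0 <= p`_i - p`_i.-1 <= 1.

(* Main.v *)
Require Import Defs.
From mathcomp Require Import all_boot all_order all_algebra.
From mathcomp Require Import all_classical.
From mathcomp Require Import constructive_ereal topology zify.

Set Implicit Arguments.
Unset Strict Implicit.
Unset Printing Implicit Defensive.

Import Order.TTheory GRing.Theory Num.Theory.

Local Open Scope classical_set_scope.
Local Open Scope ring_scope.

(** Everything rests on one observation about a single map f: the orbit closure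
    of y is the point y together with the orbit closure of f y.  A closed
    invariant proper subset of the former therefore misses y and lies in the
    latter, so passing from f y to y either leaves the orbit closure unchanged
    or raises its height by exactly one ([height_succ]).  An orbit closure of a
    periodic point is a finite cycle, hence minimal, hence of height 0
    ([height_periodic]).  Thus, if the orbit of y is finite, the heights along
    it descend to 0 without skipping a value: with its own height, every
    smaller natural number is also the height of some orbit closure
    ([heights_initial_segment]).

    In a Fort space of finite height every orbit is finite.  An infinite orbit
    would force the particular point b to be fixed, because the orbit converges
    to b; the tails of the orbit, each completed by b, would then be an infinite
    strictly decreasing sequence of closed invariant sets
    ([fort_height_finite_orbit]).  So the heights of orbit closures form an
    initial segment of the natural numbers, and an indicator sequence, which
    lists all of them in increasing order, starts at 0 and has steps 0 or 1
    ([fort_unit_step]).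

    Conversely, from such a sequence q one builds a forest on {0, ..., n}: the
    indices with q i = 0 are fixed, and every other i is sent to some j < i with
    q j = q i - 1, which exists since q has no gaps.  The orbit of i then has
    height q i, and the initial segments {0, ..., k} form a chain of maximal
    length, so that the whole system has height n ([model_indicator]).  A finite
    discrete space is a Fort space for any choice of its particular point, which
    closes the cycle of implications.

    The count comes from recording at which of the n steps the sequence
    increases: summing up such a record of booleans is a bijection
    ([staircase]). *)

(** * Chains of closed invariant sets *)

Section Chains.
Variable T : transformation_semigroup.
Implicit Types V W : set T.

Lemma chain_top W n : invariant_chain W n -> closed W /\ ts_invariant W.
Proof. by move=> [Z [Zinv _ <-]]. Qed.

Lemma chain0 W : closed W -> ts_invariant W -> invariant_chain W 0.
Proof.
move=> cW iW; exists (fun=> W); split => // i j.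
by rewrite !ord1.
Qed.

Lemma chainS V W n : invariant_chain V n -> closed W -> ts_invariant W ->
  V `<` W -> invariant_chain W n.+1.
Proof.
move=> [Z [Zinv Zlt ZV]] cW iW VW.
exists (fun i : 'I_n.+2 => if (i < n.+1)%N then Z (inord i) else W).
split=> [i|i j ij|].
- by case: ifP => // _; exact: Zinv.
- have i_lt : (i < n.+1)%N by apply: leq_trans ij _; rewrite -ltnS.
  rewrite i_lt; case: ifP => j_lt; first by apply: Zlt; rewrite !inordK.
  have [->|ineq] := eqVneq (inord i : 'I_n.+1) ord_max; first by rewrite ZV.
  have ilt : ((inord i : 'I_n.+1) < (ord_max : 'I_n.+1))%N.
    by rewrite ltn_neqAle ineq -ltnS ltn_ord.
  move: (Zlt _ _ ilt).
  rewrite ZV => -[iV _]; split; first exact: subset_trans iV VW.1.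
  by move=> Wi; apply: VW.2; exact: subset_trans Wi iV.
- by rewrite /= ltnn.
Qed.

Lemma chain_pred W n : invariant_chain W n.+1 ->
  exists2 V, V `<` W & invariant_chain V n.
Proof.
move=> [Z [Zinv Zlt <-]].
exists (Z (inord n)); first by apply: Zlt; rewrite inordK.
exists (fun i => Z (widen_ord (leqnSn _) i)); split => [i|i j ij|].
- exact: Zinv.
- exact: Zlt.
- by congr Z; apply: val_inj; rewrite /= inordK.
Qed.

(** Replacing the top term by a larger set keeps the length: the terms below
    the top are proper subsets of the new top as well. *)
Lemma chain_sub V W n : invariant_chain V n -> closed W -> ts_invariant W ->
  V `<=` W -> invariant_chain W n.
Proof.
case: n => [|n] VW cW iW VW'; first exact: chain0.
have [U [UV nUV] Un] := chain_pred VW; apply: (chainS Un) => //; split.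
  exact: subset_trans UV VW'.
by move=> WU; apply: nUV; exact: subset_trans VW' WU.
Qed.

(** An attained supremum, since a nonempty bounded set of integers contains its
    supremum: every height computation below becomes a statement about the
    lengths of chains. *)
Lemma heightP W n : height W = n%:Z%:E <->
  invariant_chain W n /\ forall m, invariant_chain W m -> (m <= n)%N.
Proof.
rewrite /height /supremum; set A := [set _ | _ in _].
split=> [|[Wn ub_n]]; last first.
  have An : A n%:Z%:E by exists n.
  case: eqP => [A0|_]; first by move: An; rewrite A0.
  have supn : supremums A n%:Z%:E.
    split=> [_ [m Wm <-]|y]; last exact.
    by rewrite lee_fin lez_nat ub_n.
  by apply: xget_unique => // y supy; exact: is_subset1_supremums supy supn.
case: eqP => // /eqP/set0P[_ [k Wk _]].
case: xgetP => // _ -> [ub_y lb_y] yE; move: ub_y lb_y; rewrite {}yE.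
move=> ub_n lb_n.
have {}ub_n m : invariant_chain W m -> (m <= n)%N.
  by move=> Wm; rewrite -lez_nat -lee_fin; apply: ub_n; exists m.
split=> //; apply: contrapT => Wn.
(* If n were not attained, then n - 1 would be a smaller upper bound. *)
have lt_n m : invariant_chain W m -> (m < n)%N.
  move=> Wm; rewrite ltn_neqAle ub_n// andbT; apply/eqP => mn.
  by apply: Wn; rewrite -mn.
have : (n%:Z%:E <= n.-1%:Z%:E)%E.
  by apply: lb_n => _ [m /lt_n ? <-]; rewrite lee_fin lez_nat; lia.
by rewrite lee_fin lez_nat; have := lt_n _ Wk; lia.
Qed.

End Chains.

(** * Orbit closures of a single map *)

Section Iterates.
Variables (Y : topologicalType) (f : Y -> Y).
Hypotheses (Y0 : [set: Y] !=set0) (Yc : compact [set: Y]).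
Hypotheses (YH : hausdorff_space Y) (fc : continuous f).

Local Notation T := (iterates_ts Y0 Yc YH fc).

Lemma ts_orbitE (y : T) : ts_orbit y = range (fun m => iter m f y).
Proof.
apply/seteqP; split=> [_ [g _ <-]|_ [m _ <-]].
  by have [m gE] := iteratesP g; exists m; rewrite // -gE.
have gP : iter m f \in iterates f by apply/mem_set; exists m.
by exists (SigSub gP).
Qed.

Lemma ts_invariantE (Z : set T) :
  ts_invariant Z <-> Z !=set0 /\ forall z, Z z -> Z (f z).
Proof.
split=> -[Z0 Zf]; split => // z.
  have gP : iter 1 f \in iterates f by apply/mem_set; exists 1%N.
  exact: (Zf z (SigSub gP)).
move=> g Zz; rewrite /= /iterates_act.
by have [m ->] := iteratesP g; elim: m => //= m; exact: Zf.
Qed.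

Lemma iter_invariant (Z : set T) (z : T) m :
  ts_invariant Z -> Z z -> Z (iter m f z).
Proof. by move=> /ts_invariantE[_ Zf] Zz; elim: m => //= m; exact: Zf. Qed.

Lemma mem_orbit_closure (y : T) m : orbit_closure y (iter m f y).
Proof. by apply: subset_closure; rewrite ts_orbitE; exists m. Qed.

Lemma orbit_closure_sub (Z : set T) (y : T) :
  closed Z -> ts_invariant Z -> Z y -> orbit_closure y `<=` Z.
Proof.
move=> /closure_id ZE iZ Zy; rewrite ZE; apply: closureS.
by rewrite ts_orbitE => _ [m _ <-]; exact: iter_invariant.
Qed.

Lemma orbit_closure_invariant (y : T) : ts_invariant (orbit_closure y).
Proof.
apply/ts_invariantE; split; first by exists y; exact: (@mem_orbit_closure y 0).
move=> z yz B /fc /yz[x [/= + Bx]].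
rewrite ts_orbitE => -[m _ mx]; exists (f x); split => //.
by exists m.+1 => //=; rewrite mx.
Qed.

Lemma orbit_closure_closed (y : T) : closed (orbit_closure y).
Proof. exact: closed_closure. Qed.

(** The orbit of y is that of f y with y added, and a point of a Hausdorff
    space is closed. *)
Lemma orbit_closureS (y : T) :
  orbit_closure y = y |` orbit_closure (f y : T).
Proof.
have clf := @orbit_closure_closed (f y).
rewrite /orbit_closure.
suff -> : ts_orbit y = y |` ts_orbit (f y : T).
  rewrite closureU -(proj1 (closure_id _) _)//.
  exact/accessible_closed_set1/hausdorff_accessible.
rewrite !ts_orbitE; apply/seteqP; split=> [_ [[|m] _ <-]|_ [->|[m _ <-]]].
- by left.
- by right; exists m; rewrite // -iterSr.
- by exists 0%N.
- by exists m.+1; rewrite // iterSr.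
Qed.

(** The orbit is a finite, hence closed, cycle; any closed invariant subset of
    it contains some point, and the forward orbit of that point returns to y. *)
Lemma height_periodic (y : T) m :
  iter m.+1 f y = y -> height (orbit_closure y) = 0%N%:Z%:E.
Proof.
move=> fy; have [cy iy] := (@orbit_closure_closed y, orbit_closure_invariant y).
apply/heightP; split; first exact: chain0.
case=> // k /chain_pred[V [Vy yV] /chain_top[cV iV]]; case: yV.
apply: orbit_closure_sub => //.
have [[z Vz] _] := iV.
have := Vy _ Vz; rewrite /orbit_closure.
have orbE : ts_orbit y = (fun k => iter k f y) @` `I_m.+1.
  rewrite ts_orbitE; apply/seteqP; split=> [_ [j _ <-]|_ [j _ <-]]; last first.
    by exists j.
  (* The orbit has period m + 1, so only the residue of the exponent matters. *)
  exists (j %% m.+1)%N; first by rewrite /= ltn_mod.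
  rewrite [in RHS](divn_eq j m.+1) addnC iterD; congr iter.
  by elim: (j %/ m.+1)%N => // q IH; rewrite mulSn iterD -IH.
have /closure_id <- : closed (ts_orbit y).
  have accY := hausdorff_accessible YH.
  rewrite orbE; apply: (proj1 accessible_finite_set_closed accY).
  exact/finite_image/finite_II.
rewrite orbE => -[j /= j_lt jz].
suff <- : iter (m.+1 - j) f z = y by exact: iter_invariant.
by rewrite -jz -iterD subnK// ltnW.
Qed.

(** The orbit closure of f y is the largest closed invariant proper subset of
    that of y: a closed invariant subset containing y is everything, and one
    that avoids y lies in the orbit closure of f y. *)
Lemma height_succ (y : T) k : ~ orbit_closure (f y : T) y ->
  height (orbit_closure (f y : T)) = k%:Z%:E ->
  height (orbit_closure y) = k.+1%:Z%:E.
Proof.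
have [cfy ify] := (@orbit_closure_closed (f y), orbit_closure_invariant (f y)).
have [cy iy] := (@orbit_closure_closed y, orbit_closure_invariant y).
move=> nfy /heightP[fyk fy_ub]; apply/heightP; split.
  apply: (chainS fyk) => //; rewrite (orbit_closureS y).
  split=> [z|]; first by right.
  by move=> sub; apply: nfy; apply: sub; left.
case=> // m /chain_pred[V [Vy yV] Vm]; rewrite ltnS; apply: fy_ub.
have [cV iV] := chain_top Vm.
apply: (chain_sub Vm) => // z Vz; have := Vy _ Vz; rewrite (orbit_closureS y).
by case=> // zy; case: yV; apply: orbit_closure_sub => //; rewrite -zy.
Qed.

Lemma orbit_closure_recurrent (y : T) : orbit_closure (f y : T) y ->
  orbit_closure y = orbit_closure (f y : T).
Proof.
by move=> fyy; rewrite (orbit_closureS y) setUidr// => _ ->.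
Qed.

(** Induction along the orbit of y, backwards from its cycle: each step either
    keeps the orbit closure or adds one new height, so no value is skipped. *)
Lemma heights_initial_segment (y : T) i j : (i < j)%N ->
  iter i f y = iter j f y ->
  exists k, height (orbit_closure y) = k%:Z%:E /\
    forall l, (l <= k)%N -> exists z : T, height (orbit_closure z) = l%:Z%:E.
Proof.
elim: i j y => [|i IH] [//|j] y ij.
  move=> /esym/height_periodic h0; exists 0%N; split => // l.
  by rewrite leqn0 => /eqP ->; exists y.
rewrite !iterSr => fij; have [k [fyk k_seg]] := IH j (f y) ij fij.
have [/orbit_closure_recurrent ->|nfy] := pselect (orbit_closure (f y : T) y).
  by exists k.
have yk := height_succ nfy fyk.
exists k.+1; split => // l; rewrite leq_eqVlt => /orP[/eqP ->|].
  by exists y.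
exact: k_seg.
Qed.

End Iterates.

(** * Finite height on Fort spaces *)

Section FortDynamics.
Variables (X : topologicalType) (b : X) (Xfort : fort_space b).
Variables (f : X -> X) (fc : continuous f).

(** If f b were not b, then the singleton of f b would be open, so by
    continuity f would send all but finitely many points to f b; two points of
    the infinite orbit would have the same image, against injectivity. *)
Lemma fort_infinite_orbit_fix (y : X) :
  injective (fun m => iter m f y) -> f b = b.
Proof.
move=> finj; apply: contrapT => fb_neq.
have fb_open : open [set f b] by apply/Xfort; left=> /= /esym.
have /Xfort[nb|] : open (f @^-1` [set f b]).
- by move/continuousP: fc; apply.
- by case: nb.
set C := ~` _ => Cfin.
have Dfin : finite_set ((fun m => iter m f y) @^-1` C).
  by apply: finite_preimage => // i j _ _; exact: finj.
have escape (D : set nat) : finite_set D -> exists m, ~ D m.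
  move=> Dfin'; apply: contrapT => /forallNP nD; apply: infinite_nat.
  by apply: sub_finite_set Dfin' => m _; exact: contrapT (nD m).
have [i /contrapT/= fi] := escape _ Dfin.
have Difin : finite_set ((fun m => iter m f y) @^-1` C `|` [set i]).
  by rewrite finite_setU.
have [j nj] := escape _ Difin.
have /contrapT/= fj : ~ C (iter j f y) by move=> Cj; apply: nj; left.
have /finj[ij] : iter i.+1 f y = iter j.+1 f y by rewrite /= fi fj.
by apply: nj; right.
Qed.

(** Along an infinite orbit, the tails completed by b decrease strictly; they
    are closed because a set whose complement omits b is closed, and invariant
    because b is fixed. *)
Lemma fort_height_finite_orbit (n : nat) :
  height [set: fort_ts Xfort fc] = n%:Z%:E ->
  forall y : X, exists i j, (i < j)%N /\ iter i f y = iter j f y.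
Proof.
move=> /heightP[_ len_ub] y; apply: contrapT => nij.
have finj : injective (fun m => iter m f y).
  move=> i j fij; apply: contrapT => /eqP; rewrite neq_ltn => /orP[ij|ji].
    by apply: nij; exists i, j.
  by apply: nij; exists j, i.
have fb := fort_infinite_orbit_fix finj.
pose Z k : set (fort_ts Xfort fc) :=
  b |` (fun m => iter m f y) @` [set m | (k <= m)%N].
have Zc k : closed (Z k).
  by rewrite -openC; apply/Xfort; left => nZb; apply: nZb; left.
have Zi k : ts_invariant (Z k).
  apply/ts_invariantE; split; first by exists b; left.
  move=> z [->|[m /= km <-]]; first by left.
  by right; exists m.+1 => //=; exact: leqW.
have Zlt k : Z k.+1 `<` Z k.
  split=> [z [->|[m /= km <-]]|]; first by left.
    by right; exists m => //; exact: ltnW.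
  have Zk : Z k (iter k f y) by right; exists k => /=.
  move=> /(_ _ Zk)[/= kb|[m /= km /finj mk]]; last by rewrite mk ltnn in km.
  have /finj : iter k.+1 f y = iter k f y by rewrite /= kb.
  by move/eqP; rewrite -[k.+1]addn1 -[X in _ == X]addn0 eqn_add2l.
have Zchain N k : invariant_chain (Z k) N.
  elim: N k => [|N IH] k; first exact: chain0.
  exact: chainS (IH k.+1) _ _ _.
suff /len_ub : invariant_chain [set: fort_ts Xfort fc] n.+1 by rewrite ltnn.
apply: (chain_sub (Zchain n.+1 0%N)) => //.
by apply/ts_invariantE; split=> //; exists b.
Qed.

(** The values of p are the heights of all orbit closures, and these form an
    initial segment; p being monotone, a jump of two or more between consecutive
    entries would leave a value that no earlier or later entry can take. *)
Lemma fort_unit_step (n : nat) (p : n.+1.-tuple int) :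
  indicator_sequence (fort_ts Xfort fc) p -> unit_step_sequence p.
Proof.
move=> [hT [y [y_all y_mono yp]]].
have per := fort_height_finite_orbit hT.
have pE (i : 'I_n.+1) : height (orbit_closure (y i)) = (p`_i)%:E.
  by rewrite yp (tnth_nth 0).
have mono (i j : 'I_n.+1) : (i <= j)%N -> p`_i <= p`_j.
  by move=> /y_mono; rewrite !pE lee_fin.
have below (i : 'I_n.+1) : exists k, p`_i = k%:Z /\
    forall l, (l <= k)%N -> exists j : 'I_n.+1, p`_j = l%:Z.
  have [u [v [uv fuv]]] := per (y i).
  have [k [ik k_seg]] := heights_initial_segment (y := y i) uv fuv.
  exists k; split.
    by apply: EFin_inj; rewrite -pE.
  move=> l /k_seg[z zl].
  have : range (@orbit_closure (fort_ts Xfort fc)) (orbit_closure z) by exists z.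
  rewrite y_all => -[j _ /= jz]; exists j.
  by apply: EFin_inj; rewrite -pE jz.
split.
  have [k [pk k_seg]] := below ord0.
  have [j pj] := k_seg 0%N (leq0n _).
  by have := mono ord0 j (leq0n _); rewrite pj; move: pk => /= ->; lia.
move=> i /andP[i_gt0 i_le].
have i_lt : (i < n.+1)%N by [].
have i'_lt : (i.-1 < n.+1)%N by lia.
have [k [/= pk k_seg]] := below (Ordinal i_lt).
have [l [/= pl _]] := below (Ordinal i'_lt).
have /= := mono (Ordinal i'_lt) (Ordinal i_lt) (leq_pred _).
rewrite pk pl => lk; apply/andP; split; first by lia.
rewrite leNgt; apply/negP => lk1.
have [j pj] : exists j : 'I_n.+1, p`_j = l.+1%:Z by apply: k_seg; lia.
have [ij|ji] := leqP i j.
  have := mono (Ordinal i_lt) j ij; rewrite /= pk pj; lia.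
have ji' : (j <= i.-1)%N by lia.
have := mono j (Ordinal i'_lt) ji'; rewrite /= pl pj; lia.
Qed.

End FortDynamics.

(** * A finite model of a unit-step sequence *)

Section DiscreteModel.
Variable n : nat.

Lemma unit_step_nat (p : n.+1.-tuple int) : unit_step_sequence p ->
  exists q : nat -> nat, [/\ q 0%N = 0%N,
    forall i, (i < n)%N -> (q i <= q i.+1 <= (q i).+1)%N
    & forall i, (i <= n)%N -> p`_i = (q i)%:Z].
Proof.
move=> [p0 pS].
have step i : (i < n)%N -> 0 <= p`_i.+1 - p`_i <= 1 by move=> ?; exact: (pS i.+1).
have pE i : (i <= n)%N -> p`_i = (absz p`_i)%:Z.
  elim: i => [|i IH] i_le; first by rewrite p0.
  by have := step i i_le; have := IH (ltnW i_le); lia.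
exists (fun i => absz p`_i); split => [|i i_lt|//]; first by rewrite p0.
by have := step i i_lt; have := pE i (ltnW i_lt); have := pE i.+1 i_lt; lia.
Qed.

Variable q : nat -> nat.
Hypotheses (q0 : q 0%N = 0%N).
Hypotheses (qS : forall i, (i < n)%N -> (q i <= q i.+1 <= (q i).+1)%N).

Lemma unit_step_mono i j : (i <= j)%N -> (j <= n)%N -> (q i <= q j)%N.
Proof.
elim: j => [|j IH]; first by rewrite leqn0 => /eqP ->.
rewrite leq_eqVlt => /orP[/eqP -> //|ij jn].
by have /andP[+ _] := qS jn; apply: leq_trans; exact: IH (ltnW jn).
Qed.

(** A discrete intermediate value property. *)
Lemma unit_step_ivt i l : (i <= n)%N -> (l < q i)%N ->
  exists2 j, (j < i)%N & q j = l.
Proof.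
elim: i => [|i IH] i_le lq; first by rewrite q0 in lq.
have [li|li|li] := ltngtP l (q i).
- by have [j ji jl] := IH (ltnW i_le) li; exists j => //; exact: leqW.
- by have := qS i_le; lia.
- by exists i.
Qed.

(** The parent map of a forest on the indices in which the node i has depth
    q i. *)
Lemma descending_map : exists f : 'I_n.+1 -> 'I_n.+1, forall i : 'I_n.+1,
  (q i = 0%N -> f i = i) /\
  ((0 < q i)%N -> (f i < i)%N /\ q i = (q (f i)).+1).
Proof.
suff step (i : 'I_n.+1) : exists j : 'I_n.+1,
  (q i = 0%N -> j = i) /\ ((0 < q i)%N -> (j < i)%N /\ q i = (q j).+1).
  by have [f fP] := choice step; exists f.
have [qi|qi] := posnP (q i); first by exists i; rewrite qi.
have [|j ji jq] := @unit_step_ivt i (q i).-1 (ltn_ord i : (i <= n)%N).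
  by rewrite prednK.
exists (Ordinal (ltn_trans ji (ltn_ord i))) => /=.
by split=> [|_]; [lia | rewrite jq prednK].
Qed.

Variable f : 'I_n.+1 -> 'I_n.+1.
Hypothesis f_fix : forall i : 'I_n.+1, q i = 0%N -> f i = i.
Hypothesis f_desc : forall i : 'I_n.+1,
  (0 < q i)%N -> (f i < i)%N /\ q i = (q (f i)).+1.

Local Notation K := (discrete_topology 'I_n.+1).
Hypotheses (K0 : [set: K] !=set0) (Kfin : finite_set [set: K]).

Local Notation T := (finite_discrete_ts K0 Kfin (f : K -> K)).

Local Notation initial k := ([set i : 'I_n.+1 | (i <= k)%N] : set T).

(** The map f never increases an index. *)
Lemma initial_invariant (k : 'I_n.+1) : ts_invariant (initial k).
Proof.
apply/ts_invariantE; split=> [|i]; first by exists k; exact: leqnn.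
move=> /= ik; have [qi|qi] := posnP (q (i : 'I_n.+1)).
  by rewrite f_fix.
by have [/ltnW fi _] := f_desc qi; exact: leq_trans fi ik.
Qed.

Lemma initial_closed (k : 'I_n.+1) : closed (initial k).
Proof. exact: (@discrete_closed K). Qed.

Lemma model_orbit_height (i : 'I_n.+1) :
  height (orbit_closure (i : T)) = (q i)%:Z%:E.
Proof.
elim/ltn_ind: {i}(i : nat) {-2}i (erefl (i : nat)) => m IH i im.
have [qi|qi] := posnP (q i).
  by rewrite qi; apply: (@height_periodic _ _ _ _ _ _ _ 0) => /=; exact: f_fix.
have [fi qfi] := f_desc qi.
rewrite qfi; apply: height_succ; last by apply: (IH (f i)); rewrite -?im.
(* Indices only decrease along orbits, so that of f i cannot return to i. *)
move=> fii; have : initial (f i) i.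
  apply: orbit_closure_sub fii; [exact: initial_closed|exact: initial_invariant|].
  exact: leqnn.
by rewrite /= leqNgt fi.
Qed.

(** Each strict inclusion in a chain gains at least one point, and the lowest
    term is nonempty; this bounds the height of the whole model by n. *)
Lemma model_chain_card (W : set T) m : invariant_chain W m ->
  (m < #|[pred i : 'I_n.+1 | (i : T) \in W]|)%N.
Proof.
elim: m W => [|m IH] W.
  by move=> /chain_top[_ [[i Wi] _]]; apply/card_gt0P; exists i; apply/mem_set.
move=> /chain_pred[V [VW WV] /IH mV]; apply: leq_ltn_trans mV _.
apply: proper_card; apply/properP; split.
  by apply/fintype.subsetP => i /set_mem/VW/mem_set.
move/existsNP: WV => [i /not_implyP[Wi nVi]]; exists i; first exact/mem_set.
by apply/negP => /set_mem.
Qed.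

Lemma model_chain_initial (k : 'I_n.+1) : invariant_chain (initial k) k.
Proof.
elim/ltn_ind: {k}(k : nat) {-2}k (erefl (k : nat)) => -[|m] IH k km.
  rewrite [X in invariant_chain _ X]km; apply: chain0.
    exact: initial_closed.
  exact: initial_invariant.
have m_lt : (m < n.+1)%N by rewrite ltnW// -km.
rewrite [X in invariant_chain _ X]km.
apply: (chainS (IH m (ltnSn _) (Ordinal m_lt) erefl)).
- exact: initial_closed.
- exact: initial_invariant.
- split=> [i|/(_ k)]; rewrite /= km; first exact: leqW.
  by rewrite ltnn => /(_ (leqnn _)).
Qed.

Lemma model_height : height [set: T] = n%:Z%:E.
Proof.
apply/heightP; split.
  have <- : initial (ord_max : 'I_n.+1) = setT.
    by apply/seteqP; split => // i _; exact: leq_ord.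
  exact: (model_chain_initial ord_max).
move=> m /model_chain_card m_lt; rewrite -ltnS; apply: leq_trans m_lt _.
by apply: leq_trans (max_card _) _; rewrite card_ord.
Qed.

(** Every point serves as its own representative: the monotonicity of q is
    exactly the ordering of the heights. *)
Lemma model_indicator (p : n.+1.-tuple int) :
  (forall i, (i <= n)%N -> p`_i = (q i)%:Z) -> indicator_sequence T p.
Proof.
move=> pE; split; first exact: model_height.
exists id; split => // [i j ij|i].
  by rewrite !model_orbit_height lee_fin lez_nat unit_step_mono// leq_ord.
by rewrite model_orbit_height (tnth_nth 0) pE// leq_ord.
Qed.

End DiscreteModel.

Lemma unit_step_finite_model n (p : n.+1.-tuple int) :
  unit_step_sequence p ->
  exists (K : discreteTopologicalType) (K0 : [set: K] !=set0)
    (Kfin : finite_set [set: K]) (f : K -> K),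
    indicator_sequence (finite_discrete_ts K0 Kfin f) p.
Proof.
move=> /unit_step_nat[q [q0 qS pE]].
have [f fP] := descending_map q0 qS.
exists (discrete_topology 'I_n.+1 : discreteTopologicalType).
have K0 : [set: discrete_topology 'I_n.+1] !=set0 by exists ord0.
have Kfin : finite_set [set: discrete_topology 'I_n.+1].
  exact: (@finite_finset 'I_n.+1).
exists K0, Kfin, f; apply: (model_indicator (q := q)) => // i.
- exact: (fP i).1.
- exact: (fP i).2.
Qed.

(** In a finite set every complement is finite, so a Fort topology on it has
    no choice but to be discrete. *)
Lemma discrete_finite_fort (K : discreteTopologicalType) (b : K) :
  finite_set [set: K] -> fort_space b.
Proof.
move=> Kfin U; split=> _; last exact: discrete_open.
by right; exact: sub_finite_set Kfin.
Qed.

(** * Counting unit-step sequences *)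

Lemma card_setT_finType (F : finType) : ([set: F] #= `I_#|F|)%card.
Proof.
have <- : range (enum_val : 'I_#|F| -> F) = [set: F].
  apply/seteqP; split => // x _; exists (enum_rank x) => //.
  exact: enum_rankK.
have img : (range (enum_val : 'I_#|F| -> F) #= [set: 'I_#|F|])%card.
  by apply: inj_card_eq => i j _ _; exact: enum_val_inj.
exact: card_eq_trans img (card_esym card_II).
Qed.

Section Count.
Variable n : nat.

Definition partial_sum (s : seq bool) (i : nat) : nat :=
  \sum_(0 <= j < i) nth false s j.

(** The unit-step sequence that increases exactly at the steps marked true. *)
Definition staircase (s : n.-tuple bool) : n.+1.-tuple int :=
  [tuple (partial_sum s i)%:Z | i < n.+1].

Lemma partial_sumS s i :
  partial_sum s i.+1 = (partial_sum s i + nth false s i)%N.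
Proof. by rewrite /partial_sum big_nat_recr. Qed.

Lemma nth_staircase s i : (i <= n)%N -> (staircase s)`_i = (partial_sum s i)%:Z.
Proof.
by move=> i_le; rewrite -[i]/(val (Ordinal (i_le : (i < n.+1)%N))) nth_mktuple.
Qed.

Lemma staircase_inj : injective staircase.
Proof.
move=> s t st; apply/val_inj/(@eq_from_nth _ false); first by rewrite !size_tuple.
move=> i; rewrite size_tuple => i_lt.
have sumE j : (j <= n)%N -> partial_sum s j = partial_sum t j.
  by move=> j_le; have := nth_staircase s j_le; rewrite st nth_staircase// => -[].
have := sumE _ i_lt; rewrite !partial_sumS (sumE _ (ltnW i_lt)) => /addnI.
by case: (nth _ s i); case: (nth _ t i).
Qed.

Lemma staircase_range :
  range staircase = [set p : n.+1.-tuple int | unit_step_sequence p].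
Proof.
apply/seteqP; split=> [_ [s _ <-]|p /unit_step_nat[q [q0 qS pE]]].
  split; first by rewrite nth_staircase// /partial_sum big_nil.
  case=> // i /= i_lt; rewrite !nth_staircase ?(ltnW i_lt)// partial_sumS.
  by case: nth; lia.
exists [tuple q i.+1 != q i | i < n] => //.
apply/val_inj/(@eq_from_nth _ 0); first by rewrite !size_tuple.
move=> i; rewrite size_tuple ltnS => i_le.
rewrite nth_staircase// pE//; congr Posz.
elim: i i_le => [|i IH] i_le; first by rewrite /partial_sum big_nil q0.
rewrite partial_sumS IH 1?ltnW//.
rewrite -[X in nth _ _ X]/(val (Ordinal i_le)) nth_mktuple /=.
by have := qS i i_le; case: eqP; lia.
Qed.

Lemma card_unit_step :
  ([set p : n.+1.-tuple int | unit_step_sequence p] #= `I_(2 ^ n))%card.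
Proof.
rewrite -staircase_range; have := card_setT_finType {: n.-tuple bool}.
rewrite card_tuple card_bool; apply: card_eq_trans.
by apply: inj_card_eq => s t _ _; exact: staircase_inj.
Qed.

End Count.

Theorem theorem4p3 (n : nat) :
  (forall p : n.+1.-tuple int,
    [<-> exists (K : discreteTopologicalType) (K0 : [set: K] !=set0)
           (Kfin : finite_set [set: K]) (f : K -> K),
           indicator_sequence (finite_discrete_ts K0 Kfin f) p;
         exists (X : topologicalType) (b : X) (Xfort : fort_space b)
           (f : X -> X) (fc : continuous f),
           indicator_sequence (fort_ts Xfort fc) p;
         unit_step_sequence p]) /\
  ([set p : n.+1.-tuple int | unit_step_sequence p] #= `I_(2 ^ n))%card.
Proof.
split; last exact: card_unit_step.
move=> p; tfae.
- move=> [K [[b b_in] [Kfin [f ind]]]].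
  exists K, b, (discrete_finite_fort b Kfin), f, (@discrete_continuous K f).
  exact: ind.
- by move=> [X [b [Xfort [f [fc]]]]]; exact: fort_unit_step.
- exact: unit_step_finite_model.
Qed.
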